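(* Let $M$ and $N$ be two nonzero modules in the category $\mathcal{U}$ and let $s$ be any nonnegative integer. If $N$ is bounded above with top nontrivial degree $n$ (i.e. $N^n\neq0$ and $N^{j}=0$ for $j>n$), then the inverse system $$\cdots\to\mathrm{Ext}^{s}_{\mathcal{U}_2}(uM,uN)\to\mathrm{Ext}^{s}_{\mathcal{U}_1}(uM,uN)\to\mathrm{Ext}^{s}_{\mathcal{U}_0}(uM,uN)$$ stabilizes and its limit is equal to $\mathrm{Ext}^{s}_{\mathcal{U}}(M,N)$. More specifically, when $k\geq 0$ and $k\geq n-1$, the maps $$\mathrm{Ext}_{\mathcal{U}_{k+1}}^{s}(uM,uN)\to\mathrm{Ext}_{\mathcal{U}_k}^{s}(uM,uN)\quad\text{and}\quad \mathrm{Ext}_{\mathcal{U}}^{s}(M,N)\to\mathrm{Ext}_{\mathcal{U}_k}^{s}(uM,uN)$$ are isomorphisms.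
   Context: A ringoid is a small preadditive category; a left module over it is a covariant additive functor to abelian groups. Let $A$ be the mod 2 Steenrod algebra. Let $\mathcal{A}$ be the ringoid with objects all integers, $\mathcal{A}(a,b)=A^{b-a}$, and composition given by multiplication ($g\circ f=gf$). Let $\mathcal{Q}$ be the quotient of $\mathcal{A}$ by the ideal generated by the morphisms $\mathrm{Sq}^{i}:n\to n+i$ with $i\geq 0$, $i>n$; $\mathcal{U}$ denotes the category of left $\mathcal{Q}$-modules, i.e. of unstable $A$-modules. For $k\ge 0$ let $\mathcal{Q}_{k}$ be the subringoid of $\mathcal{Q}$ (all objects; morphism sets subgroups closed under composition, containing identities) generated by $\mathrm{Sq}^{i}:n\to n+i$ with $i\geq 0$, $n-i<k$. $\mathcal{U}_{k}$ is the category of left $\mathcal{Q}_{k}$-modules. $N^n$ denotes the degree $n$ part (value at $n$) of $N$. The inclusions $\mathcal{Q}_0\to\mathcal{Q}_1\to\cdots\to\mathcal{Q}_k\to\mathcal{Q}_{k+1}\to\cdots\to\mathcal{Q}$ induce, by restriction, forgetful functors, all denoted $u$, $\mathcal{U}\to\mathcal{U}_k$ and $\mathcal{U}_{k+1}\to\mathcal{U}_k$. These are exact and preserve projectives, and hence induce maps on Ext groups: apply $u$ to a projective resolution of the first argument and to the maps into the second. All maps in the claim are these induced maps. *)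

(* Defs.v *)
From HB Require Import structures.
From mathcomp Require Import all_boot all_order all_algebra.
From mathcomp Require Import finmap monalg.
From mathcomp Require Import boolp.

Set Implicit Arguments.
Unset Strict Implicit.
Unset Printing Implicit Defensive.

Import Order.TTheory GRing.Theory Num.Theory.
Local Open Scope ring_scope.
Local Open Scope quotient_scope.

Record subgroup (V : zmodType) := Subgroup {
  sgmem :> V -> Prop;
  sgmem0 : sgmem 0;
  sgmemB : forall x y, sgmem x -> sgmem y -> sgmem (x - y) }.

Definition sgpred (V : zmodType) (S : subgroup V) : {pred V} :=
  fun x => `[< S x >].

Lemma sgpred_closed (V : zmodType) (S : subgroup V) : zmod_closed (sgpred S).
Proof.
split=> [|x y]; rewrite !unfold_in.
  by apply/asboolP; exact: sgmem0.
by move=> /asboolP Sx /asboolP Sy; apply/asboolP; exact: sgmemB.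
Qed.

HB.instance Definition _ (V : zmodType) (S : subgroup V) :=
  GRing.isZmodClosed.Build V (sgpred S) (sgpred_closed S).

Lemma sgmemN (V : zmodType) (S : subgroup V) x : S x -> S (- x).
Proof. by rewrite -sub0r; apply: sgmemB; exact: sgmem0. Qed.

Lemma sgmemD (V : zmodType) (S : subgroup V) x y : S x -> S y -> S (x + y).
Proof. by move=> Sx /sgmemN; rewrite -{2}[y]opprK; exact: sgmemB. Qed.

Definition subz (V : zmodType) (S : subgroup V) := {x : V | x \in sgpred S}.
HB.instance Definition _ (V : zmodType) (S : subgroup V) :=
  SubChoice.on (subz S).
HB.instance Definition _ (V : zmodType) (S : subgroup V) :=
  [SubChoice_isSubZmodule of subz S by <:].

Definition mksub (V : zmodType) (S : subgroup V) (x : V) (Sx : S x) : subz S :=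
  exist _ x (asboolT Sx).

Lemma subzP (V : zmodType) (S : subgroup V) (x : subz S) : S (val x).
Proof. exact: (asboolW (valP x)). Qed.

Definition quotz (V : zmodType) (S : subgroup V) := Quotient.quot (sgpred S).
HB.instance Definition _ (V : zmodType) (S : subgroup V) :=
  GRing.Zmodule.on (quotz S).

Definition cls (V : zmodType) (S : subgroup V) (x : V) : quotz S :=
  \pi_(Quotient.quot (sgpred S)) x.
Definition rep (V : zmodType) (S : subgroup V) (x : quotz S) : V :=
  repr (x : Quotient.quot (sgpred S)).

Section QuotientTheory.
Variables (V : zmodType) (S : subgroup V).

Lemma repK (x : quotz S) : cls S (rep x) = x.
Proof. exact: reprK. Qed.

Lemma clsP (x y : V) : cls S x = cls S y <-> S (x - y).
Proof.
rewrite /cls; split.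
  by move=> /eqP; rewrite -Quotient.idealrBE => /asboolW.
by move=> Sxy; apply/eqP; rewrite -Quotient.idealrBE; apply: asboolT.
Qed.

Lemma cls_is_zmod_morphism : zmod_morphism (cls S).
Proof. by move=> x y; rewrite /cls raddfB. Qed.
HB.instance Definition _ :=
  GRing.isZmodMorphism.Build V (quotz S) (cls S) cls_is_zmod_morphism.

Lemma clsD x y : cls S (x + y) = cls S x + cls S y.
Proof. exact: raddfD. Qed.

Lemma rep_clsB (x : V) : S (x - rep (cls S x)).
Proof. by apply/clsP; rewrite repK. Qed.
End QuotientTheory.

Section RingQuotient.
Variables (R : nzRingType) (X : R -> Prop).

Inductive in_ideal : R -> Prop :=
| in_ideal_gen x : X x -> in_ideal x
| in_ideal0 : in_ideal 0
| in_idealB x y : in_ideal x -> in_ideal y -> in_ideal (x - y)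
| in_idealMl a x : in_ideal x -> in_ideal (a * x)
| in_idealMr a x : in_ideal x -> in_ideal (x * a).

Definition ideal := Subgroup in_ideal0 in_idealB.

Definition ring_quot := quotz ideal.
HB.instance Definition _ := GRing.Zmodule.on ring_quot.

Definition rqcls : R -> ring_quot := cls ideal.
Definition rqone : ring_quot := rqcls 1.
Definition rqmul (x y : ring_quot) : ring_quot := rqcls (rep x * rep y).

Lemma rqclsM x y : rqcls (x * y) = rqmul (rqcls x) (rqcls y).
Proof.
apply/clsP.
have -> : x * y - rep (rqcls x) * rep (rqcls y) =
   (x - rep (rqcls x)) * y + rep (rqcls x) * (y - rep (rqcls y)).
  by rewrite mulrBl mulrBr addrA subrK.
apply: sgmemD.
  by apply: in_idealMr; exact: (rep_clsB ideal x).
by apply: in_idealMl; exact: (rep_clsB ideal y).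
Qed.

Lemma rqind (P : ring_quot -> Prop) : (forall x, P (rqcls x)) -> forall x, P x.
Proof. by move=> H x; rewrite -[x]repK; exact: H. Qed.

Lemma rqmulA : associative rqmul.
Proof.
elim/rqind=> x; elim/rqind=> y; elim/rqind=> z.
by rewrite -!rqclsM mulrA.
Qed.
Lemma rqmul1 : left_id rqone rqmul.
Proof. by elim/rqind=> x; rewrite -rqclsM mul1r. Qed.
Lemma rqmulr1 : right_id rqone rqmul.
Proof. by elim/rqind=> x; rewrite -rqclsM mulr1. Qed.
Lemma rqmulDl : left_distributive rqmul +%R.
Proof.
elim/rqind=> x; elim/rqind=> y; elim/rqind=> z.
by rewrite -[rqcls x + _]clsD -!rqclsM mulrDl [LHS]clsD.
Qed.
Lemma rqmulDr : right_distributive rqmul +%R.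
Proof.
elim/rqind=> x; elim/rqind=> y; elim/rqind=> z.
by rewrite -[rqcls y + _]clsD -!rqclsM mulrDr [LHS]clsD.
Qed.
HB.instance Definition _ := GRing.Zmodule_isPzRing.Build ring_quot
  rqmulA rqmul1 rqmulr1 rqmulDl rqmulDr.
End RingQuotient.

Definition free_alg := {malg 'F_2[{fmonom nat}]}.
HB.instance Definition _ := GRing.NzRing.on free_alg.

Definition free_Sq (i : nat) : free_alg := << fmu i >>.

Inductive steenrod_rel : free_alg -> Prop :=
| rel_Sq0 : steenrod_rel (free_Sq 0 - 1)
| rel_Adem (i j : nat) : (0 < i < 2 * j)%N ->
    steenrod_rel (free_Sq i * free_Sq j -
      \sum_(c < (i %/ 2).+1)
         (free_Sq (i + j - c) * free_Sq c) *+ 'C(j - c - 1, i - 2 * c)).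

Definition steenrod := ring_quot steenrod_rel.
HB.instance Definition _ := GRing.PzRing.on steenrod.

Definition Sq (i : nat) : steenrod := rqcls steenrod_rel (free_Sq i).

(* Over F_2 every element of the span of the monomials in the Sq^i of degree d
   is a sum of such monomials. *)
Definition in_deg (d : int) (x : steenrod) : Prop :=
  exists2 ws : seq (seq nat), {in ws, forall w, (sumn w)%:Z = d} &
    x = \sum_(w <- ws) \prod_(i <- w) Sq i.

Lemma steenrod_addxx (x : steenrod) : x + x = 0.
Proof.
elim/rqind: x => x; rewrite -[LHS]clsD.
suff -> : x + x = 0 by exact: raddf0.
rewrite -mulr2n -[LHS](@scaler_nat 'F_2 {malg 'F_2[{fmonom nat}]}).
have -> : 2%:R = 0 :> 'F_2 by exact: val_inj.
exact: scale0r.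
Qed.

Lemma in_deg0 d : in_deg d 0.
Proof. by exists [::]; rewrite ?big_nil. Qed.

Lemma in_degB d x y : in_deg d x -> in_deg d y -> in_deg d (x - y).
Proof.
move=> [ws wsd ->] [vs vsd ->]; exists (ws ++ vs).
  by move=> w; rewrite mem_cat => /orP[/wsd|/vsd].
rewrite big_cat /=; congr (_ + _); apply/esym/eqP.
by rewrite -subr_eq0 opprK steenrod_addxx.
Qed.

Lemma in_deg1 : in_deg 0 1.
Proof.
exists [:: [::]]; last by rewrite big_seq1 big_nil.
by move=> w; rewrite inE => /eqP ->.
Qed.

Lemma in_degSq i : in_deg i%:Z (Sq i).
Proof.
exists [:: [:: i]]; last by rewrite !big_seq1.
by move=> w; rewrite inE => /eqP -> /=; rewrite addn0.
Qed.

Lemma in_degM d e x y : in_deg d x -> in_deg e y -> in_deg (d + e) (x * y).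
Proof.
move=> [ws wsd ->] [vs vsd ->]; exists [seq w ++ v | w <- ws, v <- vs].
  move=> _ /allpairsP[[w v] /= [/wsd wd /vsd ve ->]].
  by rewrite sumn_cat PoszD wd ve.
rewrite big_allpairs_dep /= mulr_suml; apply: eq_bigr => w _.
by rewrite mulr_sumr; apply: eq_bigr => v _; rewrite big_cat.
Qed.

Definition steenrod_deg (d : int) := Subgroup (in_deg0 d) (@in_degB d).

Record ringoid := Ringoid {
  obj :> Type;
  hom : obj -> obj -> zmodType;
  idm : forall a, hom a a;
  mcomp : forall a b c, hom b c -> hom a b -> hom a c;
  mcompA : forall a b c d (h : hom c d) (g : hom b c) (f : hom a b),
    mcomp h (mcomp g f) = mcomp (mcomp h g) f;
  mcomp1m : forall a b (f : hom a b), mcomp (idm b) f = f;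
  mcompm1 : forall a b (f : hom a b), mcomp f (idm a) = f;
  mcompDl : forall a b c (g g' : hom b c) (f : hom a b),
    mcomp (g + g') f = mcomp g f + mcomp g' f;
  mcompDr : forall a b c (g : hom b c) (f f' : hom a b),
    mcomp g (f + f') = mcomp g f + mcomp g f' }.
Arguments idm {r} a.
Arguments mcomp {r a b c} g f.

Section RingoidTheory.
Variable R : ringoid.
Implicit Types a b c : R.

Lemma mcomp0m a b c (f : hom a b) : mcomp (0 : hom b c) f = 0.
Proof. by apply: (addIr (mcomp 0 f)); rewrite -mcompDl !add0r. Qed.
Lemma mcompm0 a b c (g : hom b c) : mcomp g (0 : hom a b) = 0.
Proof. by apply: (addIr (mcomp g 0)); rewrite -mcompDr !add0r. Qed.
Lemma mcompNm a b c (g : hom b c) (f : hom a b) : mcomp (- g) f = - mcomp g f.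
Proof. by apply/eqP; rewrite -addr_eq0 -mcompDl addNr mcomp0m. Qed.
Lemma mcompmN a b c (g : hom b c) (f : hom a b) : mcomp g (- f) = - mcomp g f.
Proof. by apply/eqP; rewrite -addr_eq0 -mcompDr addNr mcompm0. Qed.

Definition morset := forall a b, hom a b -> Prop.
End RingoidTheory.

Section QuotientRingoid.
Variables (R : ringoid) (X : morset R).

Inductive mor_ideal : forall a b : R, hom a b -> Prop :=
| mor_ideal_gen a b (f : hom a b) : X f -> mor_ideal f
| mor_ideal0 a b : mor_ideal (0 : hom a b)
| mor_idealB a b (f g : hom a b) :
    mor_ideal f -> mor_ideal g -> mor_ideal (f - g)
| mor_idealMl a b c (g : hom b c) (f : hom a b) :
    mor_ideal f -> mor_ideal (mcomp g f)
| mor_idealMr a b c (g : hom b c) (f : hom a b) :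
    mor_ideal g -> mor_ideal (mcomp g f).

Definition mor_ideal_sg (a b : R) : subgroup (hom a b) :=
  Subgroup (mor_ideal0 a b) (@mor_idealB a b).

Definition qhom (a b : R) : zmodType := quotz (mor_ideal_sg a b).
Definition qcls (a b : R) (f : hom a b) : qhom a b := cls (mor_ideal_sg a b) f.
Definition qcomp (a b c : R) (g : qhom b c) (f : qhom a b) : qhom a c :=
  qcls (mcomp (rep g) (rep f)).

Lemma qclsM (a b c : R) (g : hom b c) (f : hom a b) :
  qcls (mcomp g f) = qcomp (qcls g) (qcls f).
Proof.
apply/clsP.
have -> : mcomp g f - mcomp (rep (qcls g)) (rep (qcls f)) =
   mcomp (g - rep (qcls g)) f + mcomp (rep (qcls g)) (f - rep (qcls f)).
  by rewrite mcompDl mcompDr mcompNm mcompmN addrA subrK.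
apply: sgmemD.
  by apply: mor_idealMr; exact: (rep_clsB (mor_ideal_sg b c) g).
by apply: mor_idealMl; exact: (rep_clsB (mor_ideal_sg a b) f).
Qed.

Lemma qind a b (P : qhom a b -> Prop) :
  (forall f, P (qcls f)) -> forall f, P f.
Proof. by move=> H f; rewrite -[f]repK; exact: H. Qed.

Lemma qclsD a b (f g : hom a b) : qcls (f + g) = qcls f + qcls g.
Proof. exact: clsD. Qed.

Lemma qcompA a b c d (h : qhom c d) (g : qhom b c) (f : qhom a b) :
  qcomp h (qcomp g f) = qcomp (qcomp h g) f.
Proof.
elim/qind: h => h; elim/qind: g => g; elim/qind: f => f.
by rewrite -!qclsM mcompA.
Qed.
Lemma qcomp1m a b (f : qhom a b) : qcomp (qcls (idm b)) f = f.
Proof. by elim/qind: f => f; rewrite -qclsM mcomp1m. Qed.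
Lemma qcompm1 a b (f : qhom a b) : qcomp f (qcls (idm a)) = f.
Proof. by elim/qind: f => f; rewrite -qclsM mcompm1. Qed.
Lemma qcompDl a b c (g g' : qhom b c) (f : qhom a b) :
  qcomp (g + g') f = qcomp g f + qcomp g' f.
Proof.
elim/qind: g => g; elim/qind: g' => g'; elim/qind: f => f.
by rewrite -qclsD -!qclsM mcompDl qclsD.
Qed.
Lemma qcompDr a b c (g : qhom b c) (f f' : qhom a b) :
  qcomp g (f + f') = qcomp g f + qcomp g f'.
Proof.
elim/qind: g => g; elim/qind: f => f; elim/qind: f' => f'.
by rewrite -qclsD -!qclsM mcompDr qclsD.
Qed.

Definition quotient_ringoid : ringoid :=
  Ringoid qcompA qcomp1m qcompm1 qcompDl qcompDr.
End QuotientRingoid.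

Section SubRingoid.
Variables (R : ringoid) (X : morset R).

Inductive mor_sub : forall a b : R, hom a b -> Prop :=
| mor_sub_gen a b (f : hom a b) : X f -> mor_sub f
| mor_sub1 a : mor_sub (idm a)
| mor_sub0 a b : mor_sub (0 : hom a b)
| mor_subB a b (f g : hom a b) : mor_sub f -> mor_sub g -> mor_sub (f - g)
| mor_subM a b c (g : hom b c) (f : hom a b) :
    mor_sub g -> mor_sub f -> mor_sub (mcomp g f).

Definition mor_sub_sg (a b : R) : subgroup (hom a b) :=
  Subgroup (mor_sub0 a b) (@mor_subB a b).

Definition shom (a b : R) : zmodType := subz (mor_sub_sg a b).
Definition sidm (a : R) : shom a a := @mksub _ (mor_sub_sg a a) _ (mor_sub1 a).
Definition scomp (a b c : R) (g : shom b c) (f : shom a b) : shom a c :=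
  @mksub _ (mor_sub_sg a c) _ (mor_subM (subzP g) (subzP f)).

Lemma scompA a b c d (h : shom c d) (g : shom b c) (f : shom a b) :
  scomp h (scomp g f) = scomp (scomp h g) f.
Proof. by apply: val_inj; exact: mcompA. Qed.
Lemma scomp1m a b (f : shom a b) : scomp (sidm b) f = f.
Proof. by apply: val_inj; exact: mcomp1m. Qed.
Lemma scompm1 a b (f : shom a b) : scomp f (sidm a) = f.
Proof. by apply: val_inj; exact: mcompm1. Qed.
Lemma scompDl a b c (g g' : shom b c) (f : shom a b) :
  scomp (g + g') f = scomp g f + scomp g' f.
Proof. by apply: val_inj; exact: mcompDl. Qed.
Lemma scompDr a b c (g : shom b c) (f f' : shom a b) :
  scomp g (f + f') = scomp g f + scomp g f'.
Proof. by apply: val_inj; exact: mcompDr. Qed.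

Definition sub_ringoid : ringoid :=
  Ringoid scompA scomp1m scompm1 scompDl scompDr.
End SubRingoid.

Record functor (R S : ringoid) := Functor {
  fobj :> R -> S;
  fmor : forall a b : R, hom a b -> hom (fobj a) (fobj b);
  fmorD : forall (a b : R) (f g : hom a b), fmor (f + g) = fmor f + fmor g;
  fmor1 : forall a : R, fmor (idm a) = idm (fobj a);
  fmorM : forall (a b c : R) (g : hom b c) (f : hom a b),
    fmor (mcomp g f) = mcomp (fmor g) (fmor f) }.
Arguments fmor {R S} _ {a b} _.

Section SubRingoidFunctors.
Variables (R : ringoid) (X Y : morset R).

Lemma sub_inclD (a b : sub_ringoid X) (f g : hom a b) :
  val (f + g) = val f + val g.
Proof. by []. Qed.
Lemma sub_incl1 (a : sub_ringoid X) : val (idm a) = @idm R a.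
Proof. by []. Qed.
Lemma sub_inclM (a b c : sub_ringoid X) (g : hom b c) (f : hom a b) :
  val (mcomp g f) = mcomp (val g) (val f).
Proof. by []. Qed.

Definition sub_incl : functor (sub_ringoid X) R :=
  @Functor (sub_ringoid X) R id (fun a b f => val f)
    sub_inclD sub_incl1 sub_inclM.

Hypothesis XY : forall (a b : R) (f : hom a b), X f -> Y f.

Lemma mor_sub_mono (a b : R) (f : hom a b) : mor_sub X f -> mor_sub Y f.
Proof.
elim=> {a b f}; [|exact: mor_sub1|exact: mor_sub0| |].
- by move=> a b f /XY; exact: mor_sub_gen.
- by move=> a b f g _ ? _ ?; exact: mor_subB.
- by move=> a b c g f _ ? _ ?; exact: mor_subM.
Qed.

Definition widen (a b : R) (f : shom X a b) : shom Y a b :=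
  @mksub _ (mor_sub_sg Y a b) _ (mor_sub_mono (subzP f)).

Lemma widenD (a b : sub_ringoid X) (f g : hom a b) :
  widen (f + g) = widen f + widen g.
Proof. exact: val_inj. Qed.
Lemma widen1 (a : sub_ringoid X) : widen (idm a) = @idm (sub_ringoid Y) a.
Proof. exact: val_inj. Qed.
Lemma widenM (a b c : sub_ringoid X) (g : hom b c) (f : hom a b) :
  widen (mcomp g f) = @mcomp (sub_ringoid Y) a b c (widen g) (widen f).
Proof. exact: val_inj. Qed.

Definition sub_widen : functor (sub_ringoid X) (sub_ringoid Y) :=
  @Functor (sub_ringoid X) (sub_ringoid Y) id (fun a b f => widen f)
    widenD widen1 widenM.
End SubRingoidFunctors.

Record lmod (R : ringoid) := LMod {
  mval :> R -> zmodType;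
  act : forall a b, hom a b -> mval a -> mval b;
  actDr : forall a b (f : hom a b) x y, act f (x + y) = act f x + act f y;
  actDl : forall a b (f g : hom a b) x, act (f + g) x = act f x + act g x;
  act1 : forall a x, act (idm a) x = x;
  actM : forall a b c (g : hom b c) (f : hom a b) x,
    act (mcomp g f) x = act g (act f x) }.
Arguments act {R} _ {a b} f x.

Definition nonzero (R : ringoid) (M : lmod R) := exists a (x : M a), x != 0.

Record mhom (R : ringoid) (M N : lmod R) := MHom {
  mfun :> forall a, M a -> N a;
  mfunD : forall a x y, @mfun a (x + y) = mfun x + mfun y;
  mnat : forall a b (f : hom a b) x, mfun (act M f x) = act N f (mfun x) }.

Section ModuleHoms.
Variables (R : ringoid) (M N : lmod R).

Lemma mhomP (f g : mhom M N) : (forall a x, f a x = g a x) -> f = g.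
Proof.
case: f g => [f fD fn] [g gD gn] /= fg.
have E : f = g by apply: functional_extensionality_dep => a; exact/funext/fg.
by subst g; congr MHom; exact: Prop_irrelevance.
Qed.

Lemma mfun0 (f : mhom M N) a : f a 0 = 0.
Proof. by apply: (addIr (f a 0)); rewrite -mfunD !add0r. Qed.
Lemma mfunN (f : mhom M N) a x : f a (- x) = - f a x.
Proof. by apply/eqP; rewrite -addr_eq0 -mfunD addNr mfun0. Qed.
Lemma mfunB (f : mhom M N) a x y : f a (x - y) = f a x - f a y.
Proof. by rewrite mfunD mfunN. Qed.

Lemma act0 a b (f : hom a b) : act M f 0 = 0.
Proof. by apply: (addIr (act M f 0)); rewrite -actDr !add0r. Qed.
Lemma actN a b (f : hom a b) x : act M f (- x) = - act M f x.
Proof. by apply/eqP; rewrite -addr_eq0 -actDr addNr act0. Qed.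
Lemma actB a b (f : hom a b) x y : act M f (x - y) = act M f x - act M f y.
Proof. by rewrite actDr actN. Qed.
End ModuleHoms.

Section ModuleHomGroup.
Variables (R : ringoid) (M N : lmod R).

HB.instance Definition _ := gen_eqMixin (mhom M N).
HB.instance Definition _ := gen_choiceMixin (mhom M N).

Program Definition mhom0 : mhom M N := MHom (mfun := fun a x => 0) _ _.
Next Obligation. by rewrite addr0. Qed.
Next Obligation. by rewrite act0. Qed.
Program Definition mhomN (f : mhom M N) : mhom M N :=
  MHom (mfun := fun a x => - f a x) _ _.
Next Obligation. by rewrite mfunD opprD. Qed.
Next Obligation. by rewrite mnat actN. Qed.
Program Definition mhomD (f g : mhom M N) : mhom M N :=
  MHom (mfun := fun a x => f a x + g a x) _ _.
Next Obligation. by rewrite !mfunD addrACA. Qed.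
Next Obligation. by rewrite !mnat actDr. Qed.

Lemma mhomDA : associative mhomD.
Proof. by move=> f g h; apply: mhomP => a x /=; rewrite addrA. Qed.
Lemma mhomDC : commutative mhomD.
Proof. by move=> f g; apply: mhomP => a x /=; rewrite addrC. Qed.
Lemma mhomD0 : left_id mhom0 mhomD.
Proof. by move=> f; apply: mhomP => a x /=; rewrite add0r. Qed.
Lemma mhomDN : left_inverse mhom0 mhomN mhomD.
Proof. by move=> f; apply: mhomP => a x /=; rewrite addNr. Qed.
HB.instance Definition _ :=
  GRing.isZmodule.Build (mhom M N) mhomDA mhomDC mhomD0 mhomDN.

Lemma mhomDE (f g : mhom M N) a x : (f + g) a x = f a x + g a x.
Proof. by []. Qed.
Lemma mhomBE (f g : mhom M N) a x : (f - g) a x = f a x - g a x.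
Proof. by []. Qed.
Lemma mhom0E a x : (0 : mhom M N) a x = 0.
Proof. by []. Qed.
End ModuleHomGroup.

Program Definition mhom_id (R : ringoid) (M : lmod R) : mhom M M :=
  MHom (mfun := fun a x => x) _ _.

Program Definition mhom_comp (R : ringoid) (L M N : lmod R)
    (g : mhom M N) (f : mhom L M) : mhom L N :=
  MHom (mfun := fun a x => g a (f a x)) _ _.
Next Obligation. by rewrite !mfunD. Qed.
Next Obligation. by rewrite !mnat. Qed.
Notation "g \oM f" := (mhom_comp g f) (at level 50, left associativity).

Definition msurj (R : ringoid) (M N : lmod R) (f : mhom M N) :=
  forall a (y : N a), exists x, f a x = y.

Definition projective (R : ringoid) (P : lmod R) :=
  forall (M N : lmod R) (e : mhom M N) (f : mhom P N), msurj e ->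
    exists g : mhom P M, e \oM g = f.

Section Kernel.
Variables (R : ringoid) (M N : lmod R) (f : mhom M N).

Lemma kerB a x y : f a x = 0 -> f a y = 0 -> f a (x - y) = 0.
Proof. by rewrite mfunB => -> ->; rewrite subr0. Qed.

Definition ker_sg a : subgroup (M a) :=
  @Subgroup _ (fun x => f a x = 0) (mfun0 f a) (@kerB a).

Lemma ker_act a b (g : hom a b) (x : subz (ker_sg a)) :
  f b (act M g (val x)) = 0.
Proof. by rewrite mnat (subzP x : f a (val x) = 0) act0. Qed.

Program Definition ker : lmod R :=
  @LMod R (fun a => subz (ker_sg a))
    (fun a b g x => @mksub _ (ker_sg b) _ (ker_act g x)) _ _ _ _.
Next Obligation. by apply: val_inj; exact: actDr. Qed.
Next Obligation. by apply: val_inj; exact: actDl. Qed.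
Next Obligation. by apply: val_inj; exact: act1. Qed.
Next Obligation. by apply: val_inj; exact: actM. Qed.

Program Definition ker_incl : mhom ker M := MHom (mfun := fun a x => val x) _ _.

Lemma ker_inclP a x : f a x = 0 <-> exists y, ker_incl a y = x.
Proof.
split=> [fx|[y <-]]; last exact: (subzP y).
by exists (@mksub _ (ker_sg a) x fx).
Qed.

Program Definition ker_lift (L : lmod R) (g : mhom L M)
    (fg : forall a x, f a (g a x) = 0) : mhom L ker :=
  MHom (mfun := fun a x => @mksub _ (ker_sg a) _ (fg a x)) _ _.
Next Obligation. by apply: val_inj; exact: mfunD. Qed.
Next Obligation. by apply: val_inj; exact: mnat. Qed.
End Kernel.

(** [free_mod M] is the free module on the underlying graded set of
    [M]: formal expressions in the generators, modulo the equations that hold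
    under every interpretation in a module. *)
Section Free.
Variables (R : ringoid) (M : lmod R).

Inductive fterm (b : R) : Type :=
| FGen a (m : M a) (f : hom a b)
| FZero
| FOpp (t : fterm b)
| FAdd (t t' : fterm b).
Arguments FGen {b a} m f.
Arguments FZero {b}.

Fixpoint feval (N : lmod R) (e : forall a, M a -> N a) b (t : fterm b) : N b :=
  match t with
  | FGen a m f => act N f (e a m)
  | FZero => 0
  | FOpp t => - feval e t
  | FAdd t t' => feval e t + feval e t'
  end.

Fixpoint fterm_act b c (g : hom b c) (t : fterm b) : fterm c :=
  match t with
  | FGen a m f => FGen m (mcomp g f)
  | FZero => FZero
  | FOpp t => FOpp (fterm_act g t)
  | FAdd t t' => FAdd (fterm_act g t) (fterm_act g t')
  end.

Lemma feval_act (N : lmod R) (e : forall a, M a -> N a) b c (g : hom b c) t :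
  feval e (fterm_act g t) = act N g (feval e t).
Proof.
elim: t => /= [a m f||t ->|t -> t' ->].
- exact: actM.
- by rewrite act0.
- by rewrite actN.
- by rewrite actDr.
Qed.

HB.instance Definition _ b := gen_eqMixin (fterm b).
HB.instance Definition _ b := gen_choiceMixin (fterm b).

Definition fequiv b (t t' : fterm b) : bool :=
  `[< forall (N : lmod R) (e : forall a, M a -> N a), feval e t = feval e t' >].

Lemma fequiv_equiv b : equiv_class_of (@fequiv b).
Proof.
split=> [t|t t'|t' t t''].
- by apply/asboolP.
- by apply/asboolP/asboolP => H N e; rewrite H.
- by move=> /asboolP H1 /asboolP H2; apply/asboolP => N e; rewrite H1.
Qed.
Canonical fequiv_rel b := EquivRelPack (@fequiv_equiv b).
Canonical fequiv_enc b := defaultEncModRel (@fequiv b).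

Definition fquot b := {eq_quot (@fequiv b)}.
HB.instance Definition _ b := Choice.on (fquot b).

Definition fcls b (t : fterm b) : fquot b := \pi_(fquot b) t.

Lemma fclsP b (t t' : fterm b) :
  (forall (N : lmod R) (e : forall a, M a -> N a), feval e t = feval e t') ->
  fcls t = fcls t'.
Proof. by move=> H; apply/eqmodP/asboolP. Qed.

Lemma fevalP b (t t' : fterm b) : fcls t = fcls t' ->
  forall (N : lmod R) (e : forall a, M a -> N a), feval e t = feval e t'.
Proof. by move=> /eqmodP/asboolP. Qed.

Lemma fquot_ind b (P : fquot b -> Prop) :
  (forall t, P (fcls t)) -> forall x, P x.
Proof. by move=> H x; rewrite -[x]reprK; exact: H. Qed.

Definition fext (N : lmod R) (e : forall a, M a -> N a) b (x : fquot b) : N b :=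
  feval e (repr x).

Lemma fextE (N : lmod R) (e : forall a, M a -> N a) b (t : fterm b) :
  fext e (fcls t) = feval e t.
Proof. by apply: fevalP; rewrite /fcls reprK. Qed.

Definition fqopp b (x : fquot b) : fquot b := fcls (FOpp (repr x)).
Definition fqadd b (x y : fquot b) : fquot b := fcls (FAdd (repr x) (repr y)).
Definition fqact b c (g : hom b c) (x : fquot b) : fquot c :=
  fcls (fterm_act g (repr x)).

Lemma fqoppE b (t : fterm b) : fqopp (fcls t) = fcls (FOpp t).
Proof. by apply: fclsP => N e /=; congr (- _); exact: fextE. Qed.
Lemma fqaddE b (t t' : fterm b) : fqadd (fcls t) (fcls t') = fcls (FAdd t t').
Proof. by apply: fclsP => N e /=; congr (_ + _); exact: fextE. Qed.
Lemma fqactE b c (g : hom b c) t : fqact g (fcls t) = fcls (fterm_act g t).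
Proof.
by apply: fclsP => N e; rewrite !feval_act; congr act; exact: fextE.
Qed.

Lemma fqaddA b : associative (@fqadd b).
Proof.
elim/fquot_ind=> t; elim/fquot_ind=> t'; elim/fquot_ind=> t''.
by rewrite !fqaddE; apply: fclsP => N e /=; rewrite addrA.
Qed.
Lemma fqaddC b : commutative (@fqadd b).
Proof.
elim/fquot_ind=> t; elim/fquot_ind=> t'.
by rewrite !fqaddE; apply: fclsP => N e /=; rewrite addrC.
Qed.
Lemma fqadd0 b : left_id (fcls FZero) (@fqadd b).
Proof.
by elim/fquot_ind=> t; rewrite fqaddE; apply: fclsP => N e /=; rewrite add0r.
Qed.
Lemma fqaddN b : left_inverse (fcls FZero) (@fqopp b) (@fqadd b).
Proof.
elim/fquot_ind=> t; rewrite fqoppE fqaddE.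
by apply: fclsP => N e /=; rewrite addNr.
Qed.
HB.instance Definition _ b :=
  GRing.isZmodule.Build (fquot b)
    (@fqaddA b) (@fqaddC b) (@fqadd0 b) (@fqaddN b).

Lemma fqactDr a b (f : hom a b) x y :
  fqact f (x + y) = fqact f x + fqact f y.
Proof.
elim/fquot_ind: x => t; elim/fquot_ind: y => t'.
by rewrite [_ + _]fqaddE !fqactE [RHS]fqaddE.
Qed.
Lemma fqactDl a b (f g : hom a b) x : fqact (f + g) x = fqact f x + fqact g x.
Proof.
elim/fquot_ind: x => t; rewrite !fqactE [RHS]fqaddE; apply: fclsP => N e /=.
by rewrite !feval_act actDl.
Qed.
Lemma fqact1 a x : fqact (idm a) x = x.
Proof.
elim/fquot_ind: x => t; rewrite fqactE; apply: fclsP => N e.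
by rewrite feval_act act1.
Qed.
Lemma fqactM a b c (g : hom b c) (f : hom a b) x :
  fqact (mcomp g f) x = fqact g (fqact f x).
Proof.
elim/fquot_ind: x => t; rewrite !fqactE; apply: fclsP => N e.
by rewrite !feval_act actM.
Qed.

Definition free_mod : lmod R :=
  @LMod R fquot fqact fqactDr fqactDl fqact1 fqactM.

Program Definition free_ext (N : lmod R) (e : forall a, M a -> N a) :
  mhom free_mod N := @MHom R free_mod N (fext e) _ _.
Next Obligation.
elim/fquot_ind: x => t; elim/fquot_ind: y => t'.
by rewrite [_ + _]fqaddE !fextE.
Qed.
Next Obligation.
by elim/fquot_ind: x => t; rewrite /= fqactE !fextE feval_act.
Qed.

Definition fgen a (m : M a) : free_mod a := fcls (FGen m (idm a)).

Lemma free_ext_gen (N : lmod R) (e : forall a, M a -> N a) a (m : M a) :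
  free_ext e a (fgen m) = e a m.
Proof. by rewrite /= fextE /= act1. Qed.

Lemma free_uniq (N : lmod R) (g h : mhom free_mod N) :
  (forall a (m : M a), g a (fgen m) = h a (fgen m)) -> g = h.
Proof.
move=> gh; apply: mhomP => b; elim/fquot_ind.
elim=> [a m f||t IH|t IH t' IH'].
- have -> : fcls (FGen m f) = act free_mod f (fgen m).
    by rewrite /= fqactE /= mcompm1.
  by rewrite !mnat gh.
- by rewrite [fcls _]/(0 : free_mod b) !mfun0.
- by rewrite -fqoppE -[fqopp _]/(- (fcls t : free_mod b)) !mfunN IH.
- rewrite -fqaddE -[fqadd _ _]/((fcls t : free_mod b) + fcls t').
  by rewrite !mfunD IH IH'.
Qed.

Lemma free_projective : projective free_mod.
Proof.
move=> K N e f e_surj.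
pose s a (m : M a) : K a := sval (cid (e_surj a (f a (fgen m)))).
exists (free_ext s); apply: free_uniq => a m.
apply: etrans (congr1 (e a) (free_ext_gen s m)) _.
exact: (svalP (cid (e_surj a (f a (fgen m))))).
Qed.

Definition free_cover : mhom free_mod M := free_ext (fun a m => m).

Lemma free_cover_surj : msurj free_cover.
Proof. by move=> a m; exists (fgen m); exact: free_ext_gen. Qed.
End Free.

Record resolution (R : ringoid) (M : lmod R) := Resolution {
  rmod :> nat -> lmod R;
  rdiff : forall i, mhom (rmod i.+1) (rmod i);
  raug : mhom (rmod 0) M;
  raug_surj : msurj raug;
  raug_exact : forall a (x : rmod 0 a),
    raug a x = 0 <-> exists y, rdiff 0 a y = x;
  rdiff_exact : forall i a (x : rmod i.+1 a),
    rdiff i a x = 0 <-> exists y, rdiff i.+1 a y = x }.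

Record proj_resolution (R : ringoid) (M : lmod R) := ProjResolution {
  pres :> resolution M;
  pres_projective : forall i, projective (pres i) }.

Section FreeResolution.
Variables (R : ringoid) (M : lmod R).

Record stage := Stage { ssrc : lmod R; stgt : lmod R; smap : mhom ssrc stgt }.
Definition next_stage (s : stage) : stage :=
  Stage (ker_incl (smap s) \oM free_cover (ker (smap s))).
Fixpoint fstage (i : nat) : stage :=
  if i is j.+1 then next_stage (fstage j) else Stage (free_cover M).

Lemma next_stageP (s : stage) a (x : ssrc s a) :
  smap s a x = 0 <-> exists y, smap (next_stage s) a y = x.
Proof.
split=> [/ker_inclP[y <-]|[y <-]].
  by have [z <-] := free_cover_surj y; exists z.
by apply/ker_inclP; exists (free_cover (ker (smap s)) a y).
Qed.

Definition free_resolution : proj_resolution M.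
Proof.
pose P i := ssrc (fstage i).
pose d i : mhom (P i.+1) (P i) := smap (fstage i.+1).
have eP a (x : P 0%N a) : free_cover M a x = 0 <-> exists y, d 0%N a y = x.
  exact: (next_stageP (s := fstage 0)).
have dP i a (x : P i.+1 a) : d i a x = 0 <-> exists y, d i.+1 a y = x.
  exact: (next_stageP (s := fstage i.+1)).
exists (@Resolution R M P d (free_cover M) (@free_cover_surj R M) eP dP).
by case=> [|i]; exact: free_projective.
Defined.
End FreeResolution.

Section Cohomology.
Variables (R : ringoid) (M : lmod R) (P : resolution M) (N : lmod R).

Definition cobd (s : nat) (f : mhom (P s) N) : mhom (P s.+1) N :=
  f \oM rdiff P s.

Lemma cobd0 s : @cobd s 0 = 0.
Proof. exact: mhomP. Qed.
Lemma cobdB s (f g : mhom (P s) N) : cobd (f - g) = cobd f - cobd g.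
Proof. exact: mhomP. Qed.

Lemma cocycleB s (f g : mhom (P s) N) :
  cobd f = 0 -> cobd g = 0 -> cobd (f - g) = 0.
Proof. by rewrite cobdB => -> ->; rewrite subr0. Qed.
Definition cocycle_sg s : subgroup (mhom (P s) N) :=
  @Subgroup _ (fun f => cobd f = 0) (@cobd0 s) (@cocycleB s).
Definition cocycle s : zmodType := subz (cocycle_sg s).

Definition is_cobd s : mhom (P s) N -> Prop :=
  if s is t.+1 then fun f => exists g, f = cobd g else fun f => f = 0.

Lemma is_cobd0 s : @is_cobd s 0.
Proof. by case: s => //= s; exists 0; rewrite cobd0. Qed.
Lemma is_cobdB s (f g : mhom (P s) N) :
  is_cobd f -> is_cobd g -> is_cobd (f - g).
Proof.
case: s f g => [|s] f g /=; first by move=> -> ->; rewrite subr0.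
by move=> [f' ->] [g' ->]; exists (f' - g'); rewrite cobdB.
Qed.
Lemma cocycle_cobd0 s : is_cobd (val (0 : cocycle s)).
Proof. exact: is_cobd0. Qed.
Lemma cocycle_cobdB s (f g : cocycle s) :
  is_cobd (val f) -> is_cobd (val g) -> is_cobd (val (f - g)).
Proof. exact: is_cobdB. Qed.
Definition cobd_sg s : subgroup (cocycle s) :=
  Subgroup (sgmem := fun f => is_cobd (val f))
    (cocycle_cobd0 s) (@cocycle_cobdB s).

Definition cohom (s : nat) : zmodType := quotz (cobd_sg s).
End Cohomology.

Definition Ext (R : ringoid) (s : nat) (M N : lmod R) : zmodType :=
  cohom (free_resolution M) N s.

Record chain_map (R : ringoid) (M N : lmod R) (P : resolution M)
    (Q : resolution N) (f : mhom M N) := ChainMap {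
  cmap :> forall i, mhom (P i) (Q i);
  cmap_aug : raug Q \oM cmap 0%N = f \oM raug P;
  cmap_diff : forall i, rdiff Q i \oM cmap i.+1 = cmap i \oM rdiff P i }.

Section Comparison.
Variables (R : ringoid) (M N : lmod R).

Lemma mhom_compE (L : lmod R) (g : mhom M N) (f : mhom L M) a x :
  (g \oM f) a x = g a (f a x).
Proof. by []. Qed.

Lemma proj_lift (P A B C : lmod R) (u : mhom A B) (v : mhom B C)
    (h : mhom P B) : projective P ->
  (forall a x, v a x = 0 <-> exists y, u a y = x) ->
  (forall a x, v a (h a x) = 0) -> exists k : mhom P A, u \oM k = h.
Proof.
move=> Pproj uv vh.
have vu a x : v a (u a x) = 0 by apply/uv; exists x.
have u_surj : msurj (ker_lift vu).
  move=> a y; have /uv[x xE] := subzP y : v a (val y) = 0.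
  by exists x; exact: val_inj.
have [k kE] := Pproj _ _ _ (ker_lift vh) u_surj.
exists k; apply: mhomP => a x.
by have /(congr1 (fun g : mhom P (ker v) => val (g a x))) := kE.
Qed.

Variables (P : proj_resolution M) (Q : resolution N) (f : mhom M N).

Record partial_lift (i : nat) := PartialLift {
  plo : mhom (P i) (Q i);
  phi : mhom (P i.+1) (Q i.+1);
  plE : rdiff Q i \oM phi = plo \oM rdiff P i }.

Lemma lift_zero : exists g : mhom (P 0%N) (Q 0%N), raug Q \oM g = f \oM raug P.
Proof. by apply: pres_projective; exact: raug_surj. Qed.

Lemma lift_one : exists g : mhom (P 1%N) (Q 1%N),
  rdiff Q 0 \oM g = sval (cid lift_zero) \oM rdiff P 0.
Proof.
apply: (proj_lift (v := raug Q)).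
- exact: pres_projective.
- exact: raug_exact.
move=> a x.
have /(congr1 (fun g : mhom (P 0%N) N => g a (rdiff P 0 a x))) /= -> :=
  svalP (cid lift_zero).
have -> : raug P a (rdiff P 0 a x) = 0 by apply/raug_exact; exists x.
exact: mfun0.
Qed.

Lemma lift_next i (l : partial_lift i) :
  exists g : mhom (P i.+2) (Q i.+2),
    rdiff Q i.+1 \oM g = phi l \oM rdiff P i.+1.
Proof.
apply: (proj_lift (v := rdiff Q i)).
- exact: pres_projective.
- exact: rdiff_exact.
move=> a x.
have /(congr1 (fun g : mhom (P i.+1) (Q i) => g a (rdiff P i.+1 a x))) /= -> :=
  plE l.
have -> : rdiff P i a (rdiff P i.+1 a x) = 0 by apply/rdiff_exact; exists x.
exact: mfun0.
Qed.

Fixpoint nth_lift i : partial_lift i :=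
  if i is j.+1 then PartialLift (svalP (cid (lift_next (nth_lift j))))
  else PartialLift (svalP (cid lift_one)).

(* a chosen chain map covering f; it is unique up to chain homotopy *)
Definition chain_lift : chain_map P Q f.
Proof.
exists (fun i => plo (nth_lift i)); first exact: (svalP (cid lift_zero)).
move=> i; exact: (plE (nth_lift i)).
Defined.
End Comparison.

Section Restriction.
Variables (R S : ringoid) (F : functor R S).

Program Definition restr (M : lmod S) : lmod R :=
  @LMod R (fun a => M (F a)) (fun a b f x => act M (fmor F f) x) _ _ _ _.
Next Obligation. exact: actDr. Qed.
Next Obligation. by rewrite fmorD actDl. Qed.
Next Obligation. by rewrite fmor1 act1. Qed.
Next Obligation. by rewrite fmorM actM. Qed.

Program Definition restr_hom (M N : lmod S) (f : mhom M N) :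
    mhom (restr M) (restr N) :=
  @MHom R (restr M) (restr N) (fun a x => f (F a) x) _ _.
Next Obligation. exact: mfunD. Qed.
Next Obligation. exact: mnat. Qed.

Definition restr_resolution (M : lmod S) (P : resolution M) :
    resolution (restr M) :=
  @Resolution R (restr M) (fun i => restr (P i))
    (fun i => restr_hom (rdiff P i)) (restr_hom (raug P))
    (fun a => @raug_surj _ _ P (F a)) (fun a => @raug_exact _ _ P (F a))
    (fun i a => @rdiff_exact _ _ P i (F a)).
End Restriction.

Section CohomologyMap.
Variables (R S : ringoid) (M N : lmod R) (M' N' : lmod S).
Variables (P : resolution M) (P' : resolution M').
Variable phi : forall s, mhom (P s) N -> mhom (P' s) N'.
Hypothesis phiB : forall s f g, @phi s (f - g) = phi f - phi g.
Hypothesis phi_cobd : forall s (f : mhom (P s) N), phi (cobd f) = cobd (phi f).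

Let phi0 s : @phi s 0 = 0.
Proof. by rewrite -[X in phi X](subrr 0) phiB subrr. Qed.

Lemma cohom_map_cocycle s (f : cocycle P N s) : cobd (phi (val f)) = 0.
Proof. by rewrite -phi_cobd (subzP f : cobd (val f) = 0). Qed.

Lemma cohom_map_cobd s (f : mhom (P s) N) : is_cobd f -> is_cobd (phi f).
Proof.
case: s f => [|s] f /=; first by move=> ->.
by move=> [g ->]; exists (phi g).
Qed.

Definition cocycle_map s (f : cocycle P N s) : cocycle P' N' s :=
  @mksub _ (cocycle_sg P' N' s) _ (cohom_map_cocycle f).

Definition cohom_map s (e : cohom P N s) : cohom P' N' s :=
  cls (cobd_sg P' N' s) (cocycle_map (rep e)).

Lemma cohom_mapE s (f : cocycle P N s) :
  cohom_map (cls (cobd_sg P N s) f) = cls (cobd_sg P' N' s) (cocycle_map f).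
Proof.
apply/esym/clsP.
have /cohom_map_cobd := rep_clsB (cobd_sg P N s) f.
by rewrite [val (f - _)]/= phiB.
Qed.

Lemma cohom_mapB s : zmod_morphism (@cohom_map s).
Proof.
move=> x y; rewrite -[x]repK -[y]repK -[X in cohom_map X]raddfB !cohom_mapE.
rewrite -[RHS]raddfB; congr cls; apply: val_inj.
exact: phiB.
Qed.
End CohomologyMap.

Section RestrictCohomology.
Variables (R S : ringoid) (F : functor R S).
Variables (M N : lmod S) (P : resolution M).

Lemma restr_homB s (f g : mhom (P s) N) :
  restr_hom F (f - g) = restr_hom F f - restr_hom F g.
Proof. exact: mhomP. Qed.
Lemma restr_hom_cobd s (f : mhom (P s) N) :
  restr_hom F (cobd f) = cobd (P := restr_resolution F P) (restr_hom F f).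
Proof. exact: mhomP. Qed.

Definition cohom_restr s (e : cohom P N s) :
    cohom (restr_resolution F P) (restr F N) s :=
  cohom_map (P' := restr_resolution F P)
    (phi := fun s f => restr_hom F f) restr_homB restr_hom_cobd e.
Lemma cohom_restrB s : zmod_morphism (@cohom_restr s).
Proof. exact: cohom_mapB. Qed.
End RestrictCohomology.

Section PullbackCohomology.
Variables (R : ringoid) (M M' N N' : lmod R).
Variables (P : resolution M) (P' : resolution M') (f : mhom M' M).
Variables (c : chain_map P' P f) (g : mhom N N').

Definition pull s (h : mhom (P s) N) : mhom (P' s) N' := g \oM h \oM c s.

Lemma pullB s (h k : mhom (P s) N) : pull (h - k) = pull h - pull k.
Proof. by apply: mhomP => a x /=; exact: mfunB. Qed.
Lemma pull_cobd s (h : mhom (P s) N) : pull (cobd h) = cobd (pull h).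
Proof.
apply: mhomP => a x /=; congr (g a (h a _)).
by have /(congr1 (fun u : mhom (P' s.+1) (P s) => u a x)) := cmap_diff c s.
Qed.

Definition cohom_pull s (e : cohom P N s) : cohom P' N' s :=
  cohom_map pullB pull_cobd e.
Lemma cohom_pullB s : zmod_morphism (@cohom_pull s).
Proof. exact: cohom_mapB. Qed.
End PullbackCohomology.

(** The map induced on Ext by restriction along [F : R -> S]. Restriction is
    applied to a projective resolution of [M] and to the cochains on it; since
    [Ext R] is computed with the chosen resolution of [M'], the result is then
    carried over by the comparison map from this resolution to the restricted
    one, a homotopy equivalence whenever restriction preserves projectives.
    Restricting in two stages is the same as restricting at once, but only up
    to an isomorphism that is the identity on elements: hence [f] and [g],
    which are identities on elements in all the uses below. *)
Section ExtRestriction.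
Variables (R S : ringoid) (F : functor R S) (M N : lmod S) (M' N' : lmod R).
Variables (f : mhom M' (restr F M)) (g : mhom (restr F N) N') (s : nat).

Definition Ext_restr (e : Ext s M N) : Ext s M' N' :=
  cohom_pull
    (chain_lift (free_resolution M') (restr_resolution F (free_resolution M)) f)
    g (cohom_restr F e).

Lemma Ext_restrB : zmod_morphism Ext_restr.
Proof.
by move=> x y; rewrite /Ext_restr cohom_restrB cohom_pullB.
Qed.
HB.instance Definition _ := GRing.isZmodMorphism.Build
  (Ext s M N) (Ext s M' N') Ext_restr Ext_restrB.
End ExtRestriction.

Definition A_hom (a b : int) : zmodType := subz (steenrod_deg (b - a)).

Lemma A_comp_deg (a b c : int) (g : A_hom b c) (f : A_hom a b) :
  in_deg (c - a) (val g * val f).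
Proof.
have -> : c - a = (c - b) + (b - a) by rewrite addrA subrK.
by apply: in_degM; [exact: (subzP g)|exact: (subzP f)].
Qed.
Lemma A_id_deg (a : int) : in_deg (a - a) 1.
Proof. by rewrite subrr; exact: in_deg1. Qed.

Definition A_id (a : int) : A_hom a a :=
  @mksub _ (steenrod_deg (a - a)) _ (A_id_deg a).
Definition A_comp (a b c : int) (g : A_hom b c) (f : A_hom a b) : A_hom a c :=
  @mksub _ (steenrod_deg (c - a)) _ (A_comp_deg g f).

Lemma A_compA a b c d (h : A_hom c d) (g : A_hom b c) (f : A_hom a b) :
  A_comp h (A_comp g f) = A_comp (A_comp h g) f.
Proof. by apply: val_inj; exact: mulrA. Qed.
Lemma A_comp1m a b (f : A_hom a b) : A_comp (A_id b) f = f.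
Proof. by apply: val_inj; exact: mul1r. Qed.
Lemma A_compm1 a b (f : A_hom a b) : A_comp f (A_id a) = f.
Proof. by apply: val_inj; exact: mulr1. Qed.
Lemma A_compDl a b c (g g' : A_hom b c) (f : A_hom a b) :
  A_comp (g + g') f = A_comp g f + A_comp g' f.
Proof. by apply: val_inj; exact: mulrDl. Qed.
Lemma A_compDr a b c (g : A_hom b c) (f f' : A_hom a b) :
  A_comp g (f + f') = A_comp g f + A_comp g f'.
Proof. by apply: val_inj; exact: mulrDr. Qed.

Definition cA : ringoid :=
  Ringoid A_compA A_comp1m A_compm1 A_compDl A_compDr.

Definition is_Sq (i : nat) (a b : cA) (f : hom a b) : Prop :=
  b = (a : int) + i%:Z /\ val (f : A_hom a b) = Sq i.

Definition unstable_rel : morset cA := fun a b f =>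
  exists2 i : nat, is_Sq i f & (a : int) < i%:Z.

Definition cQ : ringoid := quotient_ringoid unstable_rel.

Definition cQ_gen (k : nat) : morset cQ := fun a b f =>
  exists (i : nat) (g : A_hom a b),
    [/\ @is_Sq i a b g, (a : int) - i%:Z < k%:Z &
        f = qcls unstable_rel (g : @hom cA a b)].

Definition cQk (k : nat) : ringoid := sub_ringoid (@cQ_gen k).

Lemma cQ_genS k (a b : cQ) (f : hom a b) :
  @cQ_gen k a b f -> @cQ_gen k.+1 a b f.
Proof.
move=> [i [g [gSq ik fE]]]; exists i, g; split=> //.
by apply: lt_le_trans ik _; rewrite lez_nat.
Qed.

Definition cQk_incl (k : nat) : functor (cQk k) cQ := sub_incl (@cQ_gen k).
Definition cQk_step (k : nat) : functor (cQk k) (cQk k.+1) :=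
  sub_widen (@cQ_genS k).

Definition umod := lmod cQ.
Definition umodk (k : nat) := lmod (cQk k).
Definition u (k : nat) (M : umod) : umodk k := restr (cQk_incl k) M.

(* u k M = u (u k.+1 M), the identity on elements *)
Program Definition u_to (k : nat) (M : umod) :
    mhom (u k M) (restr (cQk_step k) (u k.+1 M)) :=
  @MHom (cQk k) (u k M) (restr (cQk_step k) (u k.+1 M)) (fun a x => x) _ _.
Program Definition u_from (k : nat) (M : umod) :
    mhom (restr (cQk_step k) (u k.+1 M)) (u k M) :=
  @MHom (cQk k) (restr (cQk_step k) (u k.+1 M)) (u k M) (fun a x => x) _ _.

Definition Ext_u (k s : nat) (M N : umod) :
    {additive Ext s M N -> Ext s (u k M) (u k N)} :=
  @Ext_restr _ _ (cQk_incl k) M N _ _ (mhom_id (u k M)) (mhom_id (u k N)) s.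

Definition Ext_step (k s : nat) (M N : umod) :
    {additive Ext s (u k.+1 M) (u k.+1 N) -> Ext s (u k M) (u k N)} :=
  @Ext_restr _ _ (cQk_step k) _ _ _ _ (u_to k M) (u_from k N) s.

Section InverseSystems.
Variables (E : nat -> zmodType) (t : forall k, {additive E k.+1 -> E k}).

Definition stabilizes := exists k0, forall k, (k0 <= k)%N -> bijective (t k).

(* The maps [p k] form a cone, and the homomorphism that they induce from [L]
   to the group of compatible sequences, i.e. to the limit of the system, is
   bijective. *)
Definition is_limit (L : zmodType) (p : forall k, {additive L -> E k}) :=
  (forall k x, t k (p k.+1 x) = p k x) /\
  forall y : (forall k, E k), (forall k, t k (y k.+1) = y k) ->
    exists! x : L, forall k, p k x = y k.
End InverseSystems.

(* Main.v *)
(** If [n <= k + 1], then [Q_k] and [Q] have the same morphisms with target of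
    degree at most [n], and no morphism lowers degrees. Let [T] be their common
    full subringoid on the objects [<= n]. A representable module restricts to
    [T] as a representable one or as zero, so restriction to [T], from [Q] as
    well as from [Q_k], preserves projectives; and it is bijective on
    homomorphisms into a module that vanishes above [n]. Hence
    [Ext_Q(M, N) -> Ext_T(M, N)] and [Ext_{Q_k}(uM, uN) -> Ext_T(M, N)] are
    isomorphisms, and so is [Ext_Q(M, N) -> Ext_{Q_k}(uM, uN)], since
    restriction maps on Ext compose. In particular no basis of the Steenrod
    algebra is needed. *)

Require Import Defs.
From mathcomp Require Import all_boot all_order all_algebra.
From mathcomp Require Import boolp zify.
Import Defs.

Set Implicit Arguments.
Unset Strict Implicit.
Unset Printing Implicit Defensive.

Import Order.TTheory GRing.Theory Num.Theory.
Local Open Scope ring_scope.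

(** * Cohomology of isomorphic cochain complexes *)

Lemma inj_surj_bij (A B : Type) (f : A -> B) :
  injective f -> (forall y, exists x, f x = y) -> bijective f.
Proof.
move=> f_inj f_surj; have fK y := svalP (cid (f_surj y)).
by exists (fun y => sval (cid (f_surj y))) => [x|y]; [apply: f_inj|]; rewrite fK.
Qed.

Lemma bij_surj (A B : Type) (f : A -> B) :
  bijective f -> forall y, exists x, f x = y.
Proof. by case=> g _ gK y; exists (g y). Qed.

Section CohomologyIsomorphisms.
Variables (R S : ringoid) (M N : lmod R) (M' N' : lmod S).
Variables (P : resolution M) (P' : resolution M').
Variable phi : forall s, mhom (P s) N -> mhom (P' s) N'.
Hypothesis phiB : forall s f g, @phi s (f - g) = phi f - phi g.
Hypothesis phi_cobd : forall s (f : mhom (P s) N), phi (cobd f) = cobd (phi f).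
Hypothesis phi_bij : forall s, bijective (@phi s).

Lemma cohom_map_bij s : bijective (cohom_map phiB phi_cobd (s := s)).
Proof.
have phi0 t : @phi t 0 = 0 by rewrite -[X in phi X](subrr 0) phiB subrr.
have phi_inj t := bij_inj (phi_bij t).
apply: inj_surj_bij => [x y|y].
  rewrite -[x]repK -[y]repK; set f := rep x; set g := rep y.
  rewrite !cohom_mapE => /clsP fg; apply/clsP; move: fg.
  rewrite /= -phiB; case: s {x y} f g => [|s] f g /=.
    by rewrite -[RHS](phi0 0%N) => /phi_inj.
  (* Surjectivity one degree lower replaces the bounding cochain [h'] by the image of some [h]. *)
  case=> h'; have [h <-] := bij_surj (phi_bij s) h'.
  by rewrite -phi_cobd => /phi_inj ->; exists h.
rewrite -[y]repK; set f' := rep y.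
have [f fE] := bij_surj (phi_bij s) (val f').
have f_cocycle : cobd f = 0.
  by apply: phi_inj; rewrite phi_cobd fE phi0; exact: (subzP f').
exists (cls (cobd_sg P N s) (@mksub _ (cocycle_sg P N s) f f_cocycle)).
by rewrite cohom_mapE; congr cls; exact: val_inj.
Qed.
End CohomologyIsomorphisms.

(** * Uniqueness of comparison maps up to homotopy *)

Section Homotopy.
Variables (R : ringoid) (M N : lmod R) (f : mhom M N).
Variables (P : proj_resolution M) (Q : resolution N) (c c' : chain_map P Q f).

Let cE i a x : rdiff Q i a (c i.+1 a x) = c i a (rdiff P i a x).
Proof. exact: (congr1 (fun g : mhom _ _ => g a x) (cmap_diff c i)). Qed.
Let cE' i a x : rdiff Q i a (c' i.+1 a x) = c' i a (rdiff P i a x).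
Proof. exact: (congr1 (fun g : mhom _ _ => g a x) (cmap_diff c' i)). Qed.

(** Both chain maps cover [f], so the augmentation kills their difference, which then lifts by
    exactness and projectivity. *)
Lemma homotopy_start :
  exists k : mhom (P 0%N) (Q 1%N), rdiff Q 0 \oM k = c 0%N - c' 0%N.
Proof.
apply: (proj_lift (v := raug Q)); first exact: pres_projective.
  exact: raug_exact.
move=> a x; rewrite mhomBE mfunB.
have cx := congr1 (fun g : mhom _ _ => g a x) (cmap_aug c).
have cx' := congr1 (fun g : mhom _ _ => g a x) (cmap_aug c').
by rewrite -[raug Q a (c 0%N a x)]/((raug Q \oM c 0%N) a x) cx
  -[raug Q a (c' 0%N a x)]/((raug Q \oM c' 0%N) a x) cx' subrr.
Qed.

(** The hypothesis is the homotopy equation precomposed with the differential of [P]. This removes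
    the homotopy from one degree lower, so a single [k] carries the induction. *)
Lemma homotopy_next i (k : mhom (P i) (Q i.+1)) :
    rdiff Q i \oM k \oM rdiff P i = (c i - c' i) \oM rdiff P i ->
  exists k' : mhom (P i.+1) (Q i.+2),
    rdiff Q i.+1 \oM k' = c i.+1 - c' i.+1 - (k \oM rdiff P i).
Proof.
move=> kE; apply: (proj_lift (v := rdiff Q i)); first exact: pres_projective.
  exact: rdiff_exact.
move=> a x; rewrite !mhomBE !mfunB cE cE'.
have /= -> := congr1 (fun g : mhom _ _ => g a x) kE.
exact: subrr.
Qed.

Lemma rdiff_rdiff i a x : rdiff P i a (rdiff P i.+1 a x) = 0.
Proof. by apply/rdiff_exact; exists x. Qed.

Lemma homotopy i : exists k : mhom (P i) (Q i.+1),
  rdiff Q i \oM k \oM rdiff P i = (c i - c' i) \oM rdiff P i.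
Proof.
elim: i => [|i [k kE]].
  by have [k kE] := homotopy_start; exists k; rewrite kE.
have [k' k'E] := homotopy_next kE; exists k'; rewrite k'E.
apply: mhomP => a x.
by rewrite !(mhom_compE, mhomBE) rdiff_rdiff mfun0 subr0.
Qed.

(** In positive degree the difference of the chain maps is d k' + k d. The cocycle [h] kills d k',
    which leaves the coboundary of h k. In degree 0 the difference is d k, which [h] kills. *)
Lemma chain_map_cohomologous s (N' : lmod R) (h : mhom (Q s) N') :
  cobd h = 0 -> is_cobd (P := P) ((h \oM c s) - (h \oM c' s)).
Proof.
move=> h0.
have hd a x : h a (rdiff Q s a x) = 0.
  exact: (congr1 (fun g : mhom _ _ => g a x) h0).
case: s h h0 hd => [|s] h h0 hd /=.
  have [k kE] := homotopy_start; apply: mhomP => a x.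
  rewrite mhomBE !mhom_compE -mfunB -mhomBE -kE; exact: hd.
have [k kE] := homotopy s; have [k' k'E] := homotopy_next kE.
exists (h \oM k); apply: mhomP => a x.
rewrite mhomBE !mhom_compE -mfunB; apply/eqP; rewrite -subr_eq0 -mfunB.
by have := congr1 (fun g : mhom _ _ => g a x) k'E;
   rewrite !mhomBE !mhom_compE => <-; rewrite hd.
Qed.
End Homotopy.

Program Definition chain_id (R : ringoid) (M : lmod R) (P : resolution M) :
  chain_map P P (mhom_id M) := ChainMap (cmap := fun i => mhom_id (P i)) _ _.
Next Obligation. exact: mhomP. Qed.
Next Obligation. exact: mhomP. Qed.

(** The map covered is a separate [h] with a proof [hE], so that it can be an identity to which g f
    is only provably equal. *)
Program Definition chain_comp (R : ringoid) (L M N : lmod R) (f : mhom L M)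
    (g : mhom M N) (h : mhom L N) (hE : g \oM f = h) (P : resolution L)
    (P' : resolution M) (P'' : resolution N)
    (c : chain_map P P' f) (d : chain_map P' P'' g) : chain_map P P'' h :=
  ChainMap (cmap := fun i => d i \oM c i) _ _.
Next Obligation.
apply: mhomP => a x.
have := congr1 (fun g : mhom _ _ => g a (c 0%N a x)) (cmap_aug d).
have := congr1 (fun g : mhom _ _ => g a x) (cmap_aug c).
by rewrite !mhom_compE => <- ->.
Qed.
Next Obligation.
apply: mhomP => a x.
have := congr1 (fun g : mhom _ _ => g a (c i.+1 a x)) (cmap_diff d i).
have := congr1 (fun g : mhom _ _ => g a x) (cmap_diff c i).
by rewrite !mhom_compE => <- ->.
Qed.

Program Definition chain_restr (R S : ringoid) (F : functor R S) (M N : lmod S)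
    (f : mhom M N) (P : resolution M) (Q : resolution N) (c : chain_map P Q f) :
    chain_map (restr_resolution F P) (restr_resolution F Q) (restr_hom F f) :=
  ChainMap (cmap := fun i => restr_hom F (c i)) _ _.
Next Obligation.
apply: mhomP => a x.
exact: (congr1 (fun g : mhom _ _ => g (F a) x) (cmap_aug c)).
Qed.
Next Obligation.
apply: mhomP => a x.
exact: (congr1 (fun g : mhom _ _ => g (F a) x) (cmap_diff c i)).
Qed.


(** The composite of [c'] and [c] covers the identity of [M], hence is homotopic to the identity of
    [P]. *)
Lemma cohom_pullK (R : ringoid) (M M' N N' : lmod R) (f : mhom M' M)
    (f' : mhom M M') (g : mhom N N') (g' : mhom N' N)
    (P : proj_resolution M) (P' : resolution M')
    (c : chain_map P' P f) (c' : chain_map P P' f') s :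
  f \oM f' = mhom_id M -> g' \oM g = mhom_id N ->
  cancel (cohom_pull (s := s) c g) (cohom_pull (s := s) c' g').
Proof.
move=> ff' g'g x; rewrite -[x]repK; set h := rep x.
rewrite /cohom_pull !cohom_mapE; apply/clsP.
have := chain_map_cohomologous (chain_comp ff' c' c) (chain_id P) (subzP h).
congr is_cobd; apply: mhomP => a y; rewrite !(mhomBE, mhom_compE) /=.
by congr (_ - _); apply/esym/(congr1 (fun u : mhom _ _ => u a _) g'g).
Qed.

(** * Restriction maps on Ext: bijectivity and composition *)

Section ExtIsomorphism.
Variables (R S : ringoid) (F : functor R S).

Definition restr_projective :=
  forall P : lmod S, projective P -> projective (restr F P).

(** Full faithfulness for one target at a time: truncation has it for modules that vanish above the
    cutoff. *)
Definition restr_ff (N : lmod S) :=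
  forall L : lmod S, bijective (fun h : mhom L N => restr_hom F h).

Variables (M N : lmod S) (M' N' : lmod R).
Variables (f : mhom M' (restr F M)) (f' : mhom (restr F M) M').
Variables (g : mhom (restr F N) N') (g' : mhom N' (restr F N)).

(** The restricted resolution is again projective, so the comparison map is a homotopy equivalence.
    On cochains, restriction is bijective by [restr_ff]. *)
Lemma Ext_restr_bij s : restr_projective -> restr_ff N ->
  f \oM f' = mhom_id _ -> f' \oM f = mhom_id _ ->
  g \oM g' = mhom_id _ -> g' \oM g = mhom_id _ ->
  bijective (Ext_restr f g (s := s)).
Proof.
move=> F_proj N_ff ff' f'f gg' g'g.
pose P := free_resolution M.
pose FP := @ProjResolution _ _ (restr_resolution F P)
  (fun i => F_proj _ (@pres_projective _ _ P i)).
pose c := chain_lift (free_resolution M') FP f.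
pose c' := chain_lift FP (free_resolution M') f'.
have pull_bij : bijective (cohom_pull (s := s) c g).
  by exists (cohom_pull (s := s) c' g'); exact: cohom_pullK.
apply: (bij_comp pull_bij); apply: cohom_map_bij => t.
exact: N_ff.
Qed.
End ExtIsomorphism.

(* Restricting in two stages and at once give modules that agree on elements
   without being convertible; [t] is the identification. *)
Section ExtComposition.
Variables (R R' S : ringoid) (G : functor R' R) (F : functor R S).
Variables (H : functor R' S).
Variable t : forall L : lmod S, mhom (restr G (restr F L)) (restr H L).
Hypothesis t_nat : forall (L L' : lmod S) (h : mhom L L'),
  t L' \oM restr_hom G (restr_hom F h) = restr_hom H h \oM t L.

Program Definition chain_nat (M : lmod S) (P : resolution M) :
    chain_map (restr_resolution G (restr_resolution F P))
      (restr_resolution H P) (t M) :=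
  ChainMap (cmap := fun i => t (P i)) _ _.

Variables (M N : lmod S) (M1 N1 : lmod R) (M2 N2 : lmod R').
Variables (f : mhom M1 (restr F M)) (g : mhom (restr F N) N1).
Variables (f1 : mhom M2 (restr G M1)) (g1 : mhom (restr G N1) N2).
Variables (f2 : mhom M2 (restr H M)) (g2 : mhom (restr H N) N2).

(** Both sides pull back the same cocycle, along two chain maps that cover [f2] and are therefore
    homotopic. *)
Lemma Ext_restr_comp s (e : Ext s M N) :
  t M \oM restr_hom G f \oM f1 = f2 -> g1 \oM restr_hom G g = g2 \oM t N ->
  Ext_restr f1 g1 (Ext_restr f g e) = Ext_restr f2 g2 e.
Proof.
move=> fE gE; rewrite -[e]repK; set h := rep e.
rewrite /Ext_restr /cohom_restr /cohom_pull !cohom_mapE; apply/clsP.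
set P := free_resolution M.
set c := chain_lift _ (restr_resolution F P) f.
set c1 := chain_lift _ _ f1.
set c2 := chain_lift _ (restr_resolution H P) f2.
have h0 : cobd (P := restr_resolution H P) (g2 \oM restr_hom H (val h)) = 0.
  apply: mhomP => a x; rewrite /= -[rdiff _ _ _ _]/(rdiff P s (H a) x).
  have /= -> := congr1 (fun u : mhom _ _ => u (H a) x) (subzP h).
  exact: mfun0.
pose c' := chain_comp fE c1 (chain_comp erefl (chain_restr G c) (chain_nat P)).
have := chain_map_cohomologous c' c2 h0.
congr is_cobd; apply: mhomP => a x; rewrite !(mhomBE, mhom_compE) /=.
congr (_ - _).
have gEx y : g1 a (g (G a) y) = g2 a (t N a y).
  exact: (congr1 (fun u : mhom (restr G (restr F N)) N2 => u a y) gE).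
have tE y : t N a (val h (F (G a)) y) = val h (H a) (t (P s) a y).
  exact: (congr1 (fun u : mhom (restr G (restr F (P s))) (restr H N) => u a y)
    (t_nat (val h))).
by rewrite gEx tE.
Qed.
End ExtComposition.

(** * Representable modules and coinduction *)

Program Definition repr_mod (S : ringoid) (s : S) : lmod S :=
  @LMod S (fun b => hom s b) (fun a b g f => mcomp g f) _ _ _ _.
Next Obligation. exact: mcompDr. Qed.
Next Obligation. exact: mcompDl. Qed.
Next Obligation. exact: mcomp1m. Qed.
Next Obligation. by rewrite mcompA. Qed.

Program Definition precomp (S : ringoid) (s t : S) (f : hom s t) :
    mhom (repr_mod t) (repr_mod s) :=
  @MHom S (repr_mod t) (repr_mod s) (fun b g => mcomp g f) _ _.
Next Obligation. exact: mcompDl. Qed.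
Next Obligation. by rewrite mcompA. Qed.

(* Coinduction, the right adjoint of restriction along [F]. *)
Section Coinduction.
Variables (R S : ringoid) (F : functor R S).

Definition restr_repr (s : S) : lmod R := restr F (repr_mod s).

Program Definition coind (A : lmod R) : lmod S :=
  @LMod S (fun s => mhom (restr_repr s) A)
    (fun s t f h => h \oM restr_hom F (precomp f)) _ _ _ _.
Next Obligation. exact: mhomP. Qed.
Next Obligation.
by apply: mhomP => ? ?; rewrite /= mcompDr; exact: mfunD.
Qed.
Next Obligation. by apply: mhomP => ? ?; rewrite /= mcompm1. Qed.
Next Obligation. by apply: mhomP => ? ?; rewrite /= mcompA. Qed.

Program Definition coind_hom (A B : lmod R) (e : mhom A B) :
    mhom (coind A) (coind B) :=
  @MHom S (coind A) (coind B) (fun s h => e \oM h) _ _.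
Next Obligation. by apply: mhomP => ? ?; rewrite /= mfunD. Qed.
Next Obligation. exact: mhomP. Qed.

(** The Yoneda map followed by restriction; as a function of [x], it is the unit of the adjunction
    between restriction and coinduction. *)
Program Definition orbit (L : lmod S) (s : S) (x : L s) :
    mhom (restr_repr s) (restr F L) :=
  @MHom R (restr_repr s) (restr F L) (fun b g => act L g x) _ _.
Next Obligation. exact: actDl. Qed.
Next Obligation. exact: actM. Qed.

Program Definition coind_adj (L : lmod S) (A : lmod R)
    (f : mhom (restr F L) A) : mhom L (coind A) :=
  @MHom S L (coind A) (fun s x => f \oM orbit x) _ _.
Next Obligation. by apply: mhomP => ? ?; rewrite /= actDr mfunD. Qed.
Next Obligation. by apply: mhomP => ? ?; rewrite /= actM. Qed.

(** The adjunct of [f]: its restriction followed by the counit, which evaluates at the identity. *)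
Program Definition coind_counit (L : lmod S) (A : lmod R)
    (f : mhom L (coind A)) : mhom (restr F L) A :=
  @MHom R (restr F L) A (fun a x => f (F a) x a (idm (F a))) _ _.
Next Obligation. by rewrite mfunD. Qed.
Next Obligation.
rewrite mnat -(mnat (f (F a) x)) /= mcomp1m.
by rewrite mcompm1.
Qed.

(** Projectivity of the restricted representables says that coinduction preserves surjections, and
    then its left adjoint preserves projectives. *)
Lemma restr_projectiveP :
  (forall s, projective (restr_repr s)) -> restr_projective F.
Proof.
move=> F_proj P P_proj A B e f e_surj.
have ce_surj : msurj (coind_hom e).
  by move=> s h; have [k <-] := F_proj s _ _ e h e_surj; exists k.
have [g gE] := P_proj _ _ _ (coind_adj f) ce_surj.
exists (coind_counit g); apply: mhomP => a x.
have gEx : e \oM g (F a) x = f \oM orbit x.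
  exact: (congr1 (fun u : mhom P (coind B) => u (F a) x) gE).
have := congr1 (fun u : mhom (restr_repr (F a)) B => u a (idm (F a))) gEx.
by rewrite /= act1.
Qed.

(** The unit from [N] to the coinduction of its restriction is then an isomorphism, and the
    adjunction identifies homs into [N] with homs of restrictions. *)
Lemma restr_ffP (N : lmod S) :
  (forall s, bijective (@orbit N s)) -> restr_ff F N.
Proof.
move=> orbit_bij L; have orbit_inj s := bij_inj (orbit_bij s).
apply: inj_surj_bij => [h h' hh'|k].
  apply: mhomP => s x; apply: orbit_inj; apply: mhomP => b g /=.
  by rewrite -!mnat; exact: (congr1 (fun u : mhom _ (restr F N) => u b _) hh').
have kE s (x : L s) : exists y : N s, orbit y = coind_adj k s x.
  exact: bij_surj.
pose h s x := sval (cid (kE s x)).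
have hE s x : orbit (h s x) = coind_adj k s x := svalP (cid (kE s x)).
have hD s x y : h s (x + y) = h s x + h s y.
  apply: orbit_inj; rewrite hE mfunD -!hE.
  by apply: mhomP => b g; rewrite mhomDE /= actDr.
have hn s t (f : hom s t) x : h t (act L f x) = act N f (h s x).
  apply: orbit_inj; rewrite hE mnat -hE.
  by apply: mhomP => b g; rewrite /= actM.
exists (MHom hD hn); apply: mhomP => a x /=.
have := congr1 (fun u : mhom (restr_repr (F a)) _ => u a (idm (F a)))
  (hE (F a) x).
by rewrite /= !act1.
Qed.

(** * Objectwise criteria on the functor *)

Definition ff_at (a : R) := forall b : R, bijective (fun f : hom a b => fmor F f).

Definition isolated (s : S) := forall (b : R) (f : hom s (F b)), f = 0.

(** Fullness at [a] makes the identity a generator of [restr_repr (F a)]. *)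
Lemma ff_at_hom_ext a (A : lmod R) (h h' : mhom (restr_repr (F a)) A) :
  ff_at a -> h a (idm (F a)) = h' a (idm (F a)) -> h = h'.
Proof.
move=> a_ff hh'; apply: mhomP => b g.
have [f <-] := bij_surj (a_ff b) g.
have -> : fmor F f = act (restr_repr (F a)) f (idm (F a)).
  by rewrite /= mcompm1.
by rewrite !mnat hh'.
Qed.

(** This module is the representable one at [a], so Yoneda applies: lift the image of the identity
    to [x] and send each morphism to its action on [x]. *)
Lemma restr_repr_ff a : ff_at a -> projective (restr_repr (F a)).
Proof.
move=> a_ff A B e f e_surj; have [x xE] := e_surj a (f a (idm (F a))).
have inv_ex b (g : hom (F a) (F b)) := bij_surj (a_ff b) g.
pose inv b (g : hom (F a) (F b)) := sval (cid (inv_ex b g)).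
have invE b g : fmor F (inv b g) = g := svalP (cid (inv_ex b g)).
have inv_inj b := bij_inj (a_ff b).
have kD b (g g' : restr_repr (F a) b) :
    act A (inv b (g + g')) x = act A (inv b g) x + act A (inv b g') x.
  by rewrite -actDl; congr act; apply: inv_inj; rewrite fmorD !invE.
have kn b c (h : hom b c) (g : restr_repr (F a) b) :
    act A (inv c (act (restr_repr (F a)) h g)) x = act A h (act A (inv b g) x).
  by rewrite -actM; congr act; apply: inv_inj; rewrite fmorM !invE.
exists (MHom kD kn); apply: (ff_at_hom_ext a_ff) => /=; rewrite -xE.
congr (e a _); rewrite -[RHS]act1; congr act.
by apply: inv_inj; rewrite invE fmor1.
Qed.

Lemma isolated_hom0 s (A : lmod R) (h : mhom (restr_repr s) A) :
  isolated s -> h = 0.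
Proof. by move=> s0; apply: mhomP => b f; rewrite (s0 b f) mfun0. Qed.

Lemma orbit_bij_ff (N : lmod S) a : ff_at a -> bijective (@orbit N (F a)).
Proof.
move=> a_ff; apply: inj_surj_bij => [x y xy|h].
  have := congr1 (fun u : mhom (restr_repr (F a)) _ => u a (idm (F a))) xy.
  by rewrite /= !act1.
exists (h a (idm (F a))); apply: (ff_at_hom_ext a_ff).
by rewrite /= act1.
Qed.

Lemma orbit_bij_isolated (N : lmod S) s :
  isolated s -> (forall x : N s, x = 0) -> bijective (@orbit N s).
Proof.
move=> s0 N0; apply: inj_surj_bij => [x y _|h]; first by rewrite (N0 x) (N0 y).
by exists 0; rewrite (isolated_hom0 h s0) [LHS](isolated_hom0 _ s0).
Qed.

Lemma restr_projective_ff :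
  (forall s, isolated s \/ exists2 a, F a = s & ff_at a) -> restr_projective F.
Proof.
move=> FP; apply: restr_projectiveP => s; case: (FP s) => [s0|[a <-]].
  move=> A B e f _; exists 0.
  exact: etrans (isolated_hom0 _ s0) (esym (isolated_hom0 _ s0)).
exact: restr_repr_ff.
Qed.

Lemma restr_ff_local (N : lmod S) :
  (forall s, isolated s /\ (forall x : N s, x = 0) \/
     exists2 a, F a = s & ff_at a) ->
  restr_ff F N.
Proof.
move=> FP; apply: restr_ffP => s; case: (FP s) => [[]|[a <-]].
  exact: orbit_bij_isolated.
exact: orbit_bij_ff.
Qed.
End Coinduction.

(** * Morphisms of [cQ] and [cQk] in low degrees *)

Lemma Sq0E : Sq 0 = 1.
Proof. by apply/clsP/in_ideal_gen; exact: rel_Sq0. Qed.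

Lemma in_deg_prod (w : seq nat) : in_deg (sumn w)%:Z (\prod_(i <- w) Sq i).
Proof.
exists [:: w]; last by rewrite big_seq1.
by move=> v; rewrite inE => /eqP ->.
Qed.

Lemma A_hom_neg (a b : int) (g : A_hom a b) : b < a -> g = 0.
Proof.
move=> ba; apply: val_inj; have [ws wsd ->] := subzP g.
case: ws wsd => [|w ws] wsd; first by rewrite big_nil.
have wd : (sumn w)%:Z = b - a by apply: wsd; rewrite mem_head.
by exfalso; lia.
Qed.

Lemma cQ_hom_neg (a b : cQ) (f : hom a b) : (b : int) < (a : int) -> f = 0.
Proof.
by move=> ba; elim/qind: f => f; rewrite (A_hom_neg f ba) /qcls raddf0.
Qed.

(* A morphism [Sq^i : m -> m + i] outside [Q_k] has [i > 0] and [m >= k + i],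
   hence target at least [k + 2]. *)
Lemma mor_sub_word (k : nat) (w : seq nat) (a b : int) (g : A_hom a b) :
  val g = \prod_(i <- w) Sq i -> (sumn w)%:Z = b - a -> b <= k.+1%:Z ->
  @mor_sub cQ (@cQ_gen k) a b (qcls unstable_rel (g : @hom cA a b)).
Proof.
elim: w b g => [|i w IHw] b g.
  rewrite big_nil => g1 /esym/eqP; rewrite subr_eq0 => /eqP ba _; subst b.
  have -> : g = A_id a by exact: val_inj.
  exact: (@mor_sub1 cQ).
rewrite big_cons /= PoszD => gE wd bk; have [i0|i_gt0] := posnP i.
  (* On the objects k and k + 1, Sq^0 is not among the generators of [cQk], so it is dropped as an
     identity. *)
  move: gE wd; rewrite i0 Sq0E mul1r add0r => gE wd; exact: IHw.
pose c := b - i%:Z.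
have wc : (sumn w)%:Z = c - a by rewrite /c addrAC -wd addrC addKr.
have h_deg : in_deg (c - a) (\prod_(j <- w) Sq j).
  by rewrite -wc; exact: in_deg_prod.
have l_deg : in_deg (b - c) (Sq i) by rewrite opprB addrC subrK; exact: in_degSq.
pose h : A_hom a c := @mksub _ (steenrod_deg (c - a)) _ h_deg.
pose l : A_hom c b := @mksub _ (steenrod_deg (b - c)) _ l_deg.
have -> : g = A_comp l h by apply: val_inj; exact: gE.
rewrite -[A_comp l h]/(@mcomp cA a c b l h) qclsM.
apply: (@mor_subM cQ _ a c b).
  apply: mor_sub_gen; exists i, l; split=> //; first by split; rewrite ?subrK.
  (* The source of this Sq^i is b - i, so the generator condition is b - 2i < k, which follows from
     b <= k + 1 and i >= 1. *)
  by rewrite /c; lia.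
by apply: IHw => //; rewrite /c; lia.
Qed.

(** A representative is a sum of words in the Sq^i of degree b - a; split them off one at a time. *)
Lemma cQ_hom_sub (k : nat) (a b : cQ) (f : hom a b) :
  (b : int) <= k.+1%:Z -> mor_sub (@cQ_gen k) f.
Proof.
move=> bk; elim/qind: f => g; have [ws] := subzP g.
elim: ws g => [|w ws IHws] g wsd gE.
  rewrite big_nil in gE.
  have -> : g = 0 by exact: val_inj.
  by rewrite /qcls raddf0; exact: mor_sub0.
have wd : (sumn w)%:Z = (b : int) - a by apply: wsd; rewrite mem_head.
have g1_deg : in_deg ((b : int) - a) (\prod_(j <- w) Sq j).
  by rewrite -wd; exact: in_deg_prod.
pose g1 : @hom cA a b := @mksub _ (steenrod_deg (b - a)) _ g1_deg.
rewrite -[g](subrK g1) qclsD.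
apply: (@sgmemD _ (mor_sub_sg (@cQ_gen k) a b)); last exact: mor_sub_word wd bk.
apply: IHws => [v vws|]; first by apply: wsd; rewrite in_cons vws orbT.
by rewrite /= gE big_cons addrC addKr.
Qed.

(** * Truncation to the objects of degree at most n *)

Definition fcomp (R' R S : ringoid) (G : functor R' R) (F : functor R S) :
  functor R' S.
Proof.
exists (fun a => F (G a)) (fun a b f => fmor F (fmor G f))
  => [a b f g|a|a b c g f].
- by rewrite !fmorD.
- by rewrite !fmor1.
- by rewrite !fmorM.
Defined.

Definition full_ringoid (R : ringoid) (T : Type) (i : T -> R) : ringoid :=
  @Ringoid T (fun a b => hom (i a) (i b)) (fun a => idm (i a))
    (fun a b c g f => mcomp g f) (fun a b c d => @mcompA R _ _ _ _)
    (fun a b => @mcomp1m R _ _) (fun a b => @mcompm1 R _ _)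
    (fun a b c => @mcompDl R _ _ _) (fun a b c => @mcompDr R _ _ _).

Definition full_incl (R : ringoid) (T : Type) (i : T -> R) :
  functor (full_ringoid i) R.
Proof. by exists i (fun a b f => f). Defined.

Section Truncation.
Variables (k : nat) (n : int).
Hypothesis nk : n - 1 <= k%:Z.

(** The truncation is taken inside [cQk], where it is full by construction; only its comparison with
    [cQ] uses the bound on n. *)
Definition bounded_obj (a : {a : int | a <= n}) : cQk k := val a.
Definition trunc_incl : functor (full_ringoid bounded_obj) (cQk k) :=
  full_incl bounded_obj.
Definition trunc_cQ : functor (full_ringoid bounded_obj) cQ :=
  fcomp trunc_incl (cQk_incl k).

Lemma trunc_incl_ff_at a : ff_at trunc_incl a.
Proof. by move=> b; exists id. Qed.

Lemma trunc_cQ_ff_at a : ff_at trunc_cQ a.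
Proof.
move=> b; apply: inj_surj_bij => [f g /val_inj //|f].
have bk : val b <= k.+1%:Z by move: (valP b) nk => /=; lia.
by exists (@mksub _ (mor_sub_sg (@cQ_gen k) _ _) _ (cQ_hom_sub f bk)).
Qed.

Lemma trunc_cQ_isolated (s : int) : n < s -> isolated trunc_cQ s.
Proof.
move=> ns b f; apply: cQ_hom_neg; exact: le_lt_trans (valP b) ns.
Qed.

Lemma trunc_incl_isolated (s : int) : n < s -> isolated trunc_incl s.
Proof.
by move=> ns b f; apply: val_inj; exact: (trunc_cQ_isolated ns (val f)).
Qed.

Lemma trunc_incl_projective : restr_projective trunc_incl.
Proof.
apply: restr_projective_ff => s;
  case: (leP (s : int) n) => [sn|/trunc_incl_isolated]; last by left.
right; exists (exist _ (s : int) sn) => //; exact: trunc_incl_ff_at.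
Qed.

Lemma trunc_cQ_projective : restr_projective trunc_cQ.
Proof.
apply: restr_projective_ff => s;
  case: (leP (s : int) n) => [sn|/trunc_cQ_isolated]; last by left.
right; exists (exist _ (s : int) sn) => //; exact: trunc_cQ_ff_at.
Qed.

Variables (M N : umod).
Hypothesis N_above : forall j : int, n < j -> forall x : N j, x = 0.

Lemma trunc_incl_ff : restr_ff trunc_incl (u k N).
Proof.
apply: restr_ff_local => s; case: (leP (s : int) n) => [sn|ns].
  by right; exists (exist _ (s : int) sn) => //; exact: trunc_incl_ff_at.
by left; split; [exact: trunc_incl_isolated|exact: N_above].
Qed.

Lemma trunc_cQ_ff : restr_ff trunc_cQ N.
Proof.
apply: restr_ff_local => s; case: (leP (s : int) n) => [sn|ns].
  by right; exists (exist _ (s : int) sn) => //; exact: trunc_cQ_ff_at.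
by left; split; [exact: trunc_cQ_isolated|exact: N_above].
Qed.

Program Definition trunc_to (L : umod) :
    mhom (restr trunc_incl (u k L)) (restr trunc_cQ L) :=
  @MHom _ (restr trunc_incl (u k L)) (restr trunc_cQ L) (fun a x => x) _ _.
Program Definition trunc_from (L : umod) :
    mhom (restr trunc_cQ L) (restr trunc_incl (u k L)) :=
  @MHom _ (restr trunc_cQ L) (restr trunc_incl (u k L)) (fun a x => x) _ _.

Lemma Ext_u_bij s : bijective (Ext_u k s M N).
Proof.
have J_bij : bijective (Ext_restr (F := trunc_incl) (mhom_id _) (mhom_id _)
    (M := u k M) (N := u k N) (s := s)).
  apply: (Ext_restr_bij (f' := mhom_id _) (g' := mhom_id _));
    [exact: trunc_incl_projective|exact: trunc_incl_ff|..]; exact: mhomP.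
have H_bij : bijective (Ext_restr (F := trunc_cQ) (trunc_to M) (trunc_from N)
    (s := s)).
  apply: (Ext_restr_bij (f' := trunc_from M) (g' := trunc_to N));
    [exact: trunc_cQ_projective|exact: trunc_cQ_ff|..]; exact: mhomP.
case: J_bij => J' JK J'K.
(* Restrictions compose, so [Ext_u] followed by the bijection to the truncation is the direct
   restriction; hence [Ext_u] is the latter followed by [J']. *)
apply: (eq_bij (bij_comp (Bijective J'K JK) H_bij)) => e.
apply: (canLR JK); apply/esym.
by apply: (Ext_restr_comp (t := trunc_to)) => *; exact: mhomP.
Qed.
End Truncation.

(** * The inverse system and its limit *)

Lemma Ext_step_u (M N : umod) (k s : nat) (e : Ext s M N) :
  Ext_step k s M N (Ext_u k.+1 s M N e) = Ext_u k s M N e.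
Proof. by apply: (Ext_restr_comp (t := u_from k)) => *; exact: mhomP. Qed.

Lemma eventually_bij_is_limit (E : nat -> zmodType)
    (t : forall k, {additive E k.+1 -> E k}) (L : zmodType)
    (p : forall k, {additive L -> E k}) (k0 : nat) :
  (forall k x, t k (p k.+1 x) = p k x) ->
  (forall k, (k0 <= k)%N -> bijective (p k)) -> is_limit t p.
Proof.
move=> tp p_bij; split=> // y ty.
have down x j K : (j <= K)%N -> p K x = y K -> p j x = y j.
  elim: K => [|K IHK]; first by rewrite leqn0 => /eqP ->.
  rewrite leq_eqVlt => /predU1P[-> //|jK] pK; apply: IHK => //.
  by rewrite -tp pK.
have [x px] := bij_surj (p_bij k0 (leqnn _)) (y k0).
have p_inj := bij_inj (p_bij k0 (leqnn _)).
exists x; split=> [k|x' px']; last by apply: p_inj; rewrite px px'.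
(* The index k + k0 lies above both k and k0: an element matching [y] there also matches it at k0,
   so it is [x], and at k. *)
have [x' px'] := bij_surj (p_bij (k + k0)%N (leq_addl _ _)) (y (k + k0)%N).
suff <- : x' = x by apply: down px'; exact: leq_addr.
by apply: p_inj; rewrite px; apply: down px'; exact: leq_addl.
Qed.

Theorem theorem6p1 (M N : umod) (s : nat) (n : int)
    (M_neq0 : nonzero M) (N_neq0 : nonzero N)
    (N_top : exists x : N n, x != 0)
    (N_above : forall j : int, n < j -> forall x : N j, x = 0) :
  [/\ stabilizes (fun k => Ext_step k s M N),
      is_limit (fun k => Ext_step k s M N) (fun k => Ext_u k s M N) &
      forall k : nat, n - 1 <= k%:Z ->
        bijective (Ext_step k s M N) /\ bijective (Ext_u k s M N)].
Proof.
have u_bij k : n - 1 <= k%:Z -> bijective (Ext_u k s M N).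
  by move=> nk; exact: Ext_u_bij nk _ _ N_above s.
have step_bij k : n - 1 <= k%:Z -> bijective (Ext_step k s M N).
  move=> nk; have nk1 : n - 1 <= k.+1%:Z by lia.
  (* Two out of three: [Ext_step] after [Ext_u] at k + 1 is [Ext_u] at k. *)
  case: (u_bij _ nk1) => v uK vK.
  apply: (eq_bij (bij_comp (u_bij _ nk) (Bijective vK uK))) => x /=.
  by rewrite -Ext_step_u vK.
(* The absolute value gives a natural threshold even when n is negative. *)
have nk k : (`|n|%N <= k)%N -> n - 1 <= k%:Z by lia.
split=> [||k kn].
- by exists `|n|%N => k /nk; exact: step_bij.
- apply: (eventually_bij_is_limit (k0 := `|n|%N)) => [k x|k /nk /u_bij //].
  exact: Ext_step_u.
- by split; [exact: step_bij|exact: u_bij].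
Qed.
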